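(* Let $(\chi_n)_{n\ge 1}$, $f$, $a$, $H$, $f^H$, $F$ and $b$ be as in the context. Let $l>0$ satisfy $$l<\min\{H-f^H,\;F(a)\}\qquad\text{and}\qquad l>b-f(b)=-F(b),$$ let $x_0\in(0,H)$ and let $(x_n)$ be the solution of $x_{n+1}=\max\{f(x_n)+l\chi_{n+1},0\}$, $n=0,1,2,\dots$, with initial value $x_0$. Then, almost surely, $x_n$ eventually gets into the interval $(a,H)$ and stays there.
   Context: $(\chi_n)_{n\ge1}$ is a sequence of independent identically distributed continuous real random variables with zero mean on a complete probability space, whose common density $\phi$ satisfies $\phi(x)>0$ for $x\in(-1,1)$ and $\phi(x)=0$ for $x\notin[-1,1]$. $f:[0,\infty)\to[0,\infty)$ is continuous, $f(0)=0$, $f(x)>0$ for $x>0$, and there are fixed positive numbers $a<H$ such that (1) $f^H:=\max_{x\in[0,H]}f(x)<H$; (2) $f(x)>f(a)>a$ for all $x\in(a,H]$. $F(x):=f(x)-x$ for $x\in[0,\infty)$, and $b:=\min\{\beta>0:\ F(\beta)=\min_{x\in[0,a]}F(x)\}$ (with $\beta$ ranging over $(0,a]$), which is assumed to exist. The initial value $x_0$ is deterministic. *)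

(* Defs.v *)
From HB Require Import structures.
From mathcomp Require Export all_boot all_order all_algebra.
From mathcomp Require Export all_classical all_reals all_analysis.
Set Implicit Arguments.
Unset Strict Implicit.
Unset Printing Implicit Defensive.
Export Order.TTheory GRing.Theory Num.Theory.
Export numFieldNormedType.Exports.
Local Open Scope classical_set_scope.
Local Open Scope ring_scope.

Definition is_max (R : realType) (A : set R) (m : R) : Prop :=
  A m /\ ubound A m.

Definition is_min (R : realType) (A : set R) (m : R) : Prop :=
  A m /\ lbound A m.

(* A sequence of random variables is independent when the product rule holds
   for every finite set of indices, enumerated here without repetition. *)
Definition independent_seq (d : measure_display) (T : measurableType d)
    (R : realType) (P : probability T R) (X : nat -> {RV P >-> R}) : Prop :=
  forall s : seq nat, uniq s ->
  forall A : nat -> set R, (forall i, measurable (A i)) ->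
    P (\bigcap_(i in [set` s]) (X i @^-1` A i)) =
    (\prod_(i <- s) P (X i @^-1` A i))%E.

(* The integral formula with A = setT already forces phi to integrate to 1. *)
Definition has_density (d : measure_display) (T : measurableType d)
    (R : realType) (P : probability T R) (X : {RV P >-> R})
    (phi : R -> R) : Prop :=
  [/\ measurable_fun [set: R] phi,
      (forall x, 0 <= phi x) &
      forall A : set R, measurable A ->
        distribution P X A =
        (\int[lebesgue_measure]_(x in A) (phi x)%:E)%E].

Definition displacement (R : realType) (f : R -> R) (x : R) : R := f x - x.

(* chi is indexed from 0: [chi n] is the noise entering the step n -> n + 1,
   i.e. the (n+1)-st term of the noise sequence chi_1, chi_2, ... *)
Fixpoint solution (R : realType) (T : Type) (f : R -> R) (l x0 : R)
    (chi : nat -> T -> R) (n : nat) (w : T) : R :=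
  if n is m.+1 then Num.max (f (solution f l x0 chi m w) + l * chi m w) 0
  else x0.

(* Main.v *)
(* Since l < H - f^H the path never reaches H, and since l < f(a) - a it never
   leaves (a, H) once inside. On [0, a] the drift f(x) - x is at least f(b) - b,
   so a noise term >= 1 - eta raises the path by at least some delta > 0, and
   k > a / delta consecutive such terms carry it above a. They occur almost
   surely: the disjoint blocks of k noise terms are independent, and each
   consists of such terms with the same probability p^k > 0. *)
Require Import Defs.
From mathcomp Require Import measurable_realfun ring lra.
Set Implicit Arguments.
Unset Strict Implicit.
Unset Printing Implicit Defensive.
Local Open Scope classical_set_scope.
Local Open Scope ring_scope.

Section runs.
Context (R : realType) (d : measure_display) (T : measurableType d)
  (P : probability T R) (E : nat -> set T) (p : R) (K : nat).
Hypothesis mE : forall i, measurable (E i).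
Hypothesis PE : forall s : seq nat, uniq s ->
  P (\bigcap_(i in [set` s]) E i) = (p ^+ size s)%:E.

Definition run j : set T := \bigcap_(i in [set` iota (j * K) K]) E i.

Lemma measurable_run j : measurable (run j).
Proof. by apply: fin_bigcap_measurable => //; exact: finite_seq. Qed.

(* Keeping an intersection of later events in the statement makes the induction
   go through using only the product rule for intersections of the [E i]. *)
Lemma probability_no_run m (s : seq nat) :
  uniq s -> all (fun i => m * K <= i)%N s ->
  P (\big[setI/setT]_(j < m) ~` run j `&` \bigcap_(i in [set` s]) E i) =
  ((1 - p ^+ K) ^+ m * p ^+ size s)%:E.
Proof.
elim: m s => [|m IHm] s us sm; first by rewrite big_ord0 setTI PE// mul1r.
have mG : measurable (\bigcap_(i in [set` s]) E i).
  by apply: fin_bigcap_measurable => //; exact: finite_seq.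
have mC : measurable (\big[setI/setT]_(j < m) ~` run j).
  by apply: bigsetI_measurable => j _; exact/measurableC/measurable_run.
have mCG := measurableI _ _ mC mG.
have sm' : all (fun i => m * K <= i)%N s.
  by apply: sub_all sm => i; apply: leq_trans; rewrite leq_mul2r leqnSn orbT.
(* The complement of [run m] is removed by taking a difference of measures. Both terms are instances
   of the induction hypothesis, the second with the indices of block [m] appended to [s]; these are
   new because every index in [s] is at least [m.+1 * K]. *)
rewrite big_ord_recr/= -setIA [X in _ `&` X]setIC setIA -setDE measureD//;
  [|exact: measurable_run|by rewrite (le_lt_trans (probability_le1 _ _)) ?ltry].
rewrite [X in (_ - X)%E](_ : _ =
    ((1 - p ^+ K) ^+ m * p ^+ size (s ++ iota (m * K) K))%:E); last first.
  rewrite -IHm.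
  - rewrite -setIA -bigcap_setU; congr (P (_ `&` bigcap _ _)).
    by apply/seteqP; split => i /=; rewrite mem_cat => /orP.
  - rewrite cat_uniq us iota_uniq andbT/=; apply/hasPn => i.
    rewrite mem_iota => /andP[_ ilt]; apply/negP => /(allP sm).
    by rewrite leqNgt mulSn addnC ilt.
  - rewrite all_cat sm'/=; apply/allP => i; rewrite mem_iota.
    by case/andP.
rewrite [X in (X - _)%E](IHm s us sm') -EFinB size_cat size_iota.
by rewrite exprD exprS; congr EFin; ring.
Qed.

(** For every [m], the event without any run lies in the event that the first [m] blocks fail, whose
    probability is the geometric term [(1 - p ^+ K) ^+ m], which tends to 0. *)
Lemma ae_run : 0 < p -> {ae P, forall w, exists j, run j w}.
Proof.
move=> p_gt0.
pose N := \bigcap_j ~` run j.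
have mN : measurable N.
  by apply: bigcap_measurable => // j _; exact/measurableC/measurable_run.
exists N; split => //; last first.
  by move=> w /= nrun j _ rj; apply: nrun; exists j.
have pX_gt0 : 0 < p ^+ K by rewrite exprn_gt0.
(* [p ^+ K] is itself a probability, that of [run 0], so the ratio [1 - p ^+ K] lies in [0, 1). *)
have pX_le1 : p ^+ K <= 1.
  rewrite -lee_fin -(size_iota 0 K) -PE ?iota_uniq//.
  by apply: probability_le1; exact: (measurable_run 0).
have PN : P N = (fine (P N))%:E by rewrite fineK// fin_num_measure.
have Nle m : fine (P N) <= (1 - p ^+ K) ^+ m.
  rewrite -lee_fin -PN.
  have := @probability_no_run m [::] isT isT.
  rewrite mulr1 => <-; apply: le_measure; rewrite ?inE//.
    apply: measurableI; last first.
      by apply: fin_bigcap_measurable => //; exact: finite_seq.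
    by apply: bigsetI_measurable => j _; exact/measurableC/measurable_run.
  move=> w Nw; split => [|i]; last by [].
  by rewrite -(bigcap_mkord m (fun j => ~` run j)) => j _; exact: Nw.
rewrite PN; congr EFin; apply/eqP; rewrite eq_le fine_ge0 ?measure_ge0// andbT.
have cvg0 : (1 - p ^+ K) ^+ m @[m --> \oo] --> (0 : R).
  by apply: cvg_expr; rewrite ger0_norm ?subr_ge0// gtrBl.
by apply: (cvgr_to_ge cvg0); apply: nearW.
Qed.
End runs.

Section density.
Context (R : realType) (d : measure_display) (T : measurableType d)
  (P : probability T R) (X : {RV P >-> R}) (phi : R -> R).
Hypothesis X_density : has_density X phi.

Lemma density_preimage_eq0 (A : set R) : measurable A ->
  (forall x, A x -> phi x = 0) -> P (X @^-1` A) = 0%E.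
Proof.
move=> mA phi0; have [_ _ /(_ A mA)] := X_density.
rewrite /distribution/= /pushforward => ->.
by apply: integral0_eq => x Ax; rewrite phi0.
Qed.

(** A nonnegative function with zero integral over [A] vanishes almost everywhere on [A]; as [phi]
    vanishes nowhere on [A], the set [A] would be null. *)
Lemma density_preimage_gt0 (A : set R) : measurable A ->
  (forall x, A x -> 0 < phi x) -> (0 < lebesgue_measure A)%E ->
  (0 < P (X @^-1` A))%E.
Proof.
move=> mA phi_gt0 A_gt0; have [mphi phi_ge0 /(_ A mA)] := X_density.
rewrite /distribution/= /pushforward => PA.
rewrite lt0e measure_ge0 andbT; apply/eqP; rewrite PA => int0.
have mphiA : measurable_fun A (fun x => (phi x)%:E).
  by apply/measurable_EFinP; exact: measurable_funTS.
have /(ae_eq_integral_abs lebesgue_measure mA mphiA) :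
    (\int[lebesgue_measure]_(x in A) `|(phi x)%:E|)%E = 0%E.
  rewrite -[RHS]int0; apply: eq_integral => x _ /=.
  by rewrite ger0_norm.
move=> [N [mN N0 AN]].
suff : (lebesgue_measure A <= lebesgue_measure N)%E by rewrite N0 leNgt A_gt0.
apply: le_measure; rewrite ?inE// => x Ax; apply: AN => /= /(_ Ax) [phix0].
by have := phi_gt0 x Ax; rewrite phix0 ltxx.
Qed.
End density.

Section path.
Context (R : realType) (f : R -> R) (l a H delta eta : R).
Context (x c : nat -> R).
Hypothesis xS : forall n, x n.+1 = Num.max (f (x n) + l * c n) 0.
Hypothesis l_gt0 : 0 < l.
Hypothesis f_lt : forall y, 0 <= y <= H -> f y + l < H.
Hypothesis f_gt : forall y, a < y <= H -> a < f y - l.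
Hypothesis f_climb : forall y, 0 <= y <= a -> y + delta <= f y + l * (1 - eta).
Hypothesis c_itv : forall n, -1 <= c n <= 1.
Hypothesis x0_in : 0 <= x 0 < H.

(** Truncation gives the lower bound; for the upper one, noise at most 1 reduces a step to
    [f_lt]. *)
Lemma path_itv n : 0 <= x n < H.
Proof.
elim: n => // n /andP[x_ge0 x_ltH].
have H_gt0 : 0 < H by exact: le_lt_trans x_ltH.
rewrite xS le_max lexx orbT gt_max H_gt0 andbT/=.
have := f_lt (y := x n); rewrite x_ge0 ltW//= => /(_ isT); apply: le_lt_trans.
by rewrite lerD2l -[leRHS]mulr1 ler_pM2l//; case/andP: (c_itv n).
Qed.

(** Noise at least -1 reduces a step to [f_gt], which applies because [path_itv] keeps the path
    below [H]. *)
Lemma path_absorb n m : (n <= m)%N -> a < x n -> a < x m.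
Proof.
move=> /subnK <-; elim: (m - n)%N => // k IHk /IHk {IHk}; rewrite addSn.
set i := (k + n)%N => ax; rewrite xS lt_max; apply/orP; left.
have /andP[_ xH] := path_itv i.
have := f_gt (y := x i); rewrite ax ltW//= => /(_ isT) /lt_le_trans; apply.
rewrite lerD2l -[leLHS]mulrN1 ler_pM2l//.
by case/andP: (c_itv i).
Qed.

(** The gain of [delta] per step is available only on [[0, a]], hence the alternative: once the path
    has passed [a], absorption takes over. *)
Lemma path_climb n k : (forall i, (i < k)%N -> 1 - eta <= c (n + i)) ->
  a < x (n + k) \/ delta *+ k <= x (n + k).
Proof.
elim: k => [|k IHk] ck.
  by right; rewrite addn0 mulr0n; case/andP: (path_itv n).
have [i ik|ax|ax] := IHk; first by apply: ck; exact: ltnW.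
  by left; apply: path_absorb ax; rewrite leq_add2l.
have [xa|xa] := leP (x (n + k)) a; last first.
  by left; apply: path_absorb xa; rewrite leq_add2l.
right; rewrite addnS xS le_max mulrSr; apply/orP; left.
have := f_climb (y := x (n + k)); rewrite xa.
case/andP: (path_itv (n + k)) => -> _ /(_ isT) => xf.
apply: le_trans (lerD ax (lexx _)) (le_trans xf _).
by rewrite lerD2l ler_pM2l// ck.
Qed.

Lemma path_reaches n k : a < delta *+ k ->
  (forall i, (i < k)%N -> 1 - eta <= c (n + i)) ->
  forall m, (n + k <= m)%N -> a < x m < H.
Proof.
move=> ak ck m nkm; have /andP[_ ->] := path_itv m; rewrite andbT.
by apply: path_absorb nkm _; case: (path_climb ck) => // /(lt_le_trans ak).
Qed.
End path.

Theorem theorem3p3 (R : realType) (d : measure_display)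
    (T : measurableType d) (P : probability T R)
    (P_complete : measure_is_complete P)
    (chi : nat -> {RV P >-> R})
    (chi_indep : independent_seq chi)
    (phi : R -> R)
    (chi_density : forall n, has_density (chi n) phi)
    (chi_mean : forall n, ('E_P[chi n] = 0)%E)
    (phi_gt0 : forall x, -1 < x < 1 -> 0 < phi x)
    (phi_eq0 : forall x, ~~ (-1 <= x <= 1) -> phi x = 0)
    (f : R -> R)
    (f_ge0 : forall x, 0 <= x -> 0 <= f x)
    (f_cont : {within `[0, +oo[, continuous f})
    (f0 : f 0 = 0)
    (f_gt0 : forall x, 0 < x -> 0 < f x)
    (a H : R) (a_gt0 : 0 < a) (a_lt_H : a < H)
    (fH : R) (fH_max : is_max (f @` `[0, H]) fH) (fH_lt : fH < H)
    (fa_gt : a < f a)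
    (f_gt_fa : forall x, a < x <= H -> f a < f x)
    (b : R)
    (b_min : is_min [set beta | 0 < beta <= a /\
                       is_min (displacement f @` `[0, a])
                              (displacement f beta)] b)
    (l : R) (l_gt0 : 0 < l)
    (l_lt : l < Num.min (H - fH) (displacement f a))
    (l_gt : b - f b < l)
    (x0 : R) (x0_in : 0 < x0 < H) :
  {ae P, forall w, exists N : nat, forall n : nat, (N <= n)%N ->
    a < solution f l x0 chi n w < H}.
Proof.
have [[_ [_ Fb_min]] _] := b_min.
move: l_lt; rewrite lt_min /displacement => /andP[l_ltH l_lta].
(* [delta] is half the slack in [l_gt]: one half is the gain per step, the other pays for noise that
   is only [1 - eta] instead of 1. *)
pose delta := (l - (b - f b)) / 2.
have delta_gt0 : 0 < delta by rewrite divr_gt0// subr_gt0.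
(* The cap 1 keeps [](1 - eta), 1[] inside (-1, 1), where [phi] is positive; [delta / l] makes the
   loss [l * eta] at most [delta]. *)
pose eta := Num.min 1 (delta / l).
have eta_gt0 : 0 < eta by rewrite lt_min ltr01 divr_gt0.
have eta_le1 : eta <= 1 by rewrite ge_min lexx.
have eta_le : l * eta <= delta by rewrite mulrC -ler_pdivlMr// ge_min lexx orbT.
have f_lt (y : R) : 0 <= y <= H -> f y + l < H.
  move=> yH; have : f y <= fH by apply: fH_max.2; exists y => //=; rewrite in_itv.
  by move: l_ltH; lra.
have f_gt y : a < y <= H -> a < f y - l by move=> /f_gt_fa; lra.
have f_climb (y : R) : 0 <= y <= a -> y + delta <= f y + l * (1 - eta).
  move=> ya; have : displacement f b <= displacement f y.
    by apply: Fb_min; exists y => //=; rewrite in_itv.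
  by rewrite /displacement mulrBr mulr1; move: eta_le; rewrite /delta; lra.
pose k := (Num.truncn (a / delta)).+1.
have ak : a < delta *+ k.
  by rewrite -mulr_natl -ltr_pdivrMr// truncnS_gt.
pose E i : set T := chi i @^-1` `[1 - eta, +oo[.
have mE i : measurable (E i) by rewrite -[E i]setTI; exact: measurable_funP.
(* Written through the common density, [p] visibly does not depend on the index. *)
pose p := fine (\int[lebesgue_measure]_(x in `[(1 - eta)%R, +oo[) (phi x)%:E)%E.
have PE1 i : P (E i) = p%:E.
  have [_ _ /(_ _ (measurable_itv `[1 - eta, +oo[))] := chi_density i.
  rewrite /distribution/= /pushforward /p => <-.
  by rewrite fineK//; apply: fin_num_measure; exact: mE.
have p_gt0 : 0 < p.
  rewrite -lte_fin -(PE1 0%N).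
  (* Positivity of [phi] is known only inside (-1, 1), so [E 0] is bounded below by the event of an
     open interval of length [eta]. *)
  have itv_gt0 : (0 < P (chi 0%N @^-1` `](1 - eta)%R, 1%R[))%E.
    apply: (density_preimage_gt0 (chi_density 0%N)) => //.
      move=> x /=; rewrite in_itv/= => xe; apply: phi_gt0; lra.
    by rewrite lebesgue_measure_itv/= lte_fin gtrBl eta_gt0 -EFinB lte_fin; lra.
  apply: lt_le_trans itv_gt0 _; apply: le_measure; rewrite ?inE//.
    by rewrite -[X in measurable X]setTI; exact: measurable_funP.
  by move=> w; rewrite /E/= !in_itv/= andbT => /andP[/ltW].
have PE s : uniq s -> P (\bigcap_(i in [set` s]) E i) = (p ^+ size s)%:E.
  move=> us; rewrite (chi_indep s us (fun=> [set` `[1 - eta, +oo[])) => [|i].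
    rewrite (eq_bigr (fun=> p%:E)) => [|i _]; last exact: PE1.
    by rewrite prodEFin big_const_seq count_predT iter_mulr_1.
  exact: measurable_itv.
(* The noise is bounded only almost surely; the countably many exceptional null sets are merged. *)
have c_ae : {ae P, forall w n, -1 <= chi n w <= 1}.
  apply: ae_foralln => n; exists (chi n @^-1` ~` `[-1, 1]); split.
  - by rewrite -[X in measurable X]setTI; apply: measurable_funP => //;
      exact: measurableC.
  - apply: (density_preimage_eq0 (chi_density n)); first exact: measurableC.
    by move=> x /= /negP; rewrite in_itv/=; exact: phi_eq0.
  - by move=> w /=; rewrite in_itv.
apply: filterS2 (ae_run k mE PE p_gt0) c_ae => w [j rj] c_itv.
(* This is the time just after block [j], whose noise terms drive the steps from [j * k] to
   [j * k + k]. *)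
exists (j * k + k)%N.
have x0_itv : 0 <= solution f l x0 chi 0 w < H.
  by case/andP: x0_in => /ltW -> ->.
apply: (path_reaches (x := solution f l x0 chi ^~ w) (c := chi ^~ w)
  (eta := eta) (fun=> erefl) l_gt0 f_lt f_gt f_climb c_itv x0_itv ak) => i ik.
have /rj : (j * k + i)%N \in iota (j * k) k.
  by rewrite mem_iota leq_addr ltn_add2l.
by rewrite /E/= in_itv/= andbT.
Qed.
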